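(* Let $k\geq 1$ and $n\geq 3$ be integers. If $n\leq 2k+1$, then $\operatorname{sdepth}(I(C_n^k))\geq 2=\operatorname{sdepth}(S/I(C_n^k))+1$. If $n\geq 2k+2$, then: (i) if $n\equiv 1,2,\dots,k\pmod{2k+1}$, then $\operatorname{sdepth}(I(C_n^k))\geq\operatorname{sdepth}(S/I(C_n^k))$; (ii) if $n\equiv 0,k+1,k+2,\dots,2k\pmod{2k+1}$, then $\operatorname{sdepth}(I(C_n^k))\geq\operatorname{sdepth}(S/I(C_n^k))+1$.
   Context: $K$ is a field and $S=K[x_1,\dots,x_n]$ is the polynomial ring. $C_n^k$ denotes the $k$-th power of the cycle on the vertex set $\{1,\dots,n\}$ ($n\ge 3$): for $1\le i<j\le n$, $\{i,j\}$ is an edge if and only if $j-i\le k$ or $j-i\ge n-k$ (so $C_n^k$ is the complete graph when $n\le 2k+1$). Its edge ideal $I(C_n^k)\subset S$ is the squarefree monomial ideal generated by all $x_ix_j$ with $\{i,j\}$ an edge of $C_n^k$. Stanley depth: let $M$ be a finitely generated $\mathbb{Z}^n$-graded $S$-module. A Stanley decomposition of $M$ is a presentation of the $K$-vector space $M$ as a finite direct sum $\mathcal{D}: M=\bigoplus_{i=1}^s v_iK[W_i]$, where each $v_i\in M$ is homogeneous, $W_i\subseteq\{x_1,\dots,x_n\}$, $v_iK[W_i]$ is the $K$-subspace generated by all $v_iw$ with $w$ a monomial in $K[W_i]$, and $v_iK[W_i]$ is a free $K[W_i]$-module. Put $\operatorname{sdepth}(\mathcal{D})=\min_i |W_i|$,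 and $\operatorname{sdepth}(M)=\max\{\operatorname{sdepth}(\mathcal{D}):\mathcal{D}\text{ a Stanley decomposition of }M\}$. *)

(* Defs.v *)
From HB Require Import structures.
From mathcomp Require Import all_boot all_order all_algebra.
From mathcomp Require Import mpoly.
From mathcomp Require Import boolp.

Set Implicit Arguments.
Unset Strict Implicit.
Unset Printing Implicit Defensive.

Import GRing.Theory.
Local Open Scope ring_scope.
Local Open Scope quotient_scope.

Definition mdegZ n (m : 'X_{1..n}) : 'rV[int]_n := \row_i (m i)%:Z.

(* A finitely generated Z^n-graded module: gm_comp a is the component of degree
   a; gm_span and gm_indep say that M is the direct sum of its components. *)
Record gradedModule (K : fieldType) (n : nat) := GradedModule {
  gm_sort :> lmodType {mpoly K[n]};
  gm_comp : 'rV[int]_n -> gm_sort -> Prop;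
  gm_comp0 : forall a, gm_comp a 0;
  gm_compD : forall a u v, gm_comp a u -> gm_comp a v -> gm_comp a (u + v);
  gm_compZ : forall a (c : K) u, gm_comp a u -> gm_comp a (c%:MP *: u);
  gm_compX : forall a (m : 'X_{1..n}) u,
    gm_comp a u -> gm_comp (mdegZ m + a) ('X_[m] *: u);
  gm_span : forall v : gm_sort, exists2 s : seq gm_sort,
    (forall u, u \in s -> exists a, gm_comp a u) & v = \sum_(u <- s) u;
  gm_indep : forall (s : seq 'rV[int]_n) (f : 'rV[int]_n -> gm_sort),
    uniq s -> (forall a, gm_comp a (f a)) ->
    \sum_(a <- s) f a = 0 -> forall a, a \in s -> f a = 0;
  gm_fg : exists (r : nat) (g : 'I_r -> gm_sort),
    forall v, exists c : 'I_r -> {mpoly K[n]}, v = \sum_i c i *: g i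
}.

Section StanleyDepth.
Variables (K : fieldType) (n : nat).
Implicit Types (M : gradedModule K n) (W : {set 'I_n}).

Definition homogeneous M (v : M) : Prop := exists a, gm_comp a v.

(* p belongs to the subring K[W] of S *)
Definition in_vars W (p : {mpoly K[n]}) : Prop :=
  forall m, m \in msupp p -> forall i, i \notin W -> m i = 0%N.

(* u belongs to vK[W], the K-span of the v * w with w a monomial of K[W] *)
Definition stanley_space M (v : M) W (u : M) : Prop :=
  exists2 p, in_vars W p & u = p *: v.

(* vK[W] is free over K[W] with basis v; in particular v is nonzero *)
Definition stanley_free M (v : M) W : Prop :=
  forall p, in_vars W p -> p *: v = 0 -> p = 0.

Record stanley_decomposition M := StanleyDecomposition {
  sd_size : nat;
  sd_gen : 'I_sd_size -> M;
  sd_vars : 'I_sd_size -> {set 'I_n};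
  sd_homogeneous : forall i, homogeneous (sd_gen i);
  sd_free : forall i, stanley_free (sd_gen i) (sd_vars i);
  sd_direct : forall u : M, exists! f : {ffun 'I_sd_size -> M},
    (forall i, stanley_space (sd_gen i) (sd_vars i) (f i)) /\ u = \sum_i f i
}.

Arguments sd_gen {M} s i.
Arguments sd_vars {M} s i.

(* As #|W| <= n, the neutral element n does not affect the minimum of a nonempty
   family; it is the value of the empty decomposition of the zero module. *)
Definition sdepth_dec M (D : stanley_decomposition M) : nat :=
  \big[minn/n]_(i < sd_size D) #|sd_vars D i|.

(* sdepth_dec D <= n for every D, so this is the maximum over all D. *)
Definition sdepth M : nat :=
  \max_(d < n.+1 | `[< exists D : stanley_decomposition M, sdepth_dec D = d >]) d.

End StanleyDepth.

(* Vertices are numbered from 0, which leaves the differences j - i unchanged;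
   for n <= k the truncated n - k is 0 and, as over the integers, every pair
   of distinct vertices is an edge. *)
Definition cycle_power (n k : nat) : rel 'I_n := fun i j =>
  (i != j) && ((maxn i j - minn i j <= k) || (n - k <= maxn i j - minn i j))%N.

Arguments cycle_power : clear implicits.

Section EdgeIdeal.
Variables (K : fieldType) (n : nat) (e : rel 'I_n).
Local Notation S := {mpoly K[n]}.

(* S^o is S as a module over itself ({mpoly K[n]} is a module over K). *)
Definition edge_ideal : {pred S^o} := fun p =>
  `[< exists c : 'I_n -> 'I_n -> S,
        p = \sum_i \sum_(j | e i j) c i j * ('X_i * 'X_j) :> S >].

Lemma edge_idealP (p : S) : reflect
  (exists c : 'I_n -> 'I_n -> S,
     p = \sum_i \sum_(j | e i j) c i j * ('X_i * 'X_j)) (p \in edge_ideal).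
Proof. exact: asboolP. Qed.

Lemma edge_ideal0 : (0 : S) \in edge_ideal.
Proof.
apply/edge_idealP; exists (fun _ _ => 0); rewrite big1 // => i _.
by rewrite big1 // => j _; rewrite mul0r.
Qed.

Lemma edge_idealD (p q : S) :
  p \in edge_ideal -> q \in edge_ideal -> p + q \in edge_ideal.
Proof.
move=> /edge_idealP[c ->] /edge_idealP[d ->]; apply/edge_idealP.
exists (fun i j => c i j + d i j).
rewrite -big_split; apply: eq_bigr => i _ /=.
rewrite -big_split; apply: eq_bigr => j _ /=.
by rewrite mulrDl.
Qed.

Lemma edge_idealM (a p : S) : p \in edge_ideal -> a * p \in edge_ideal.
Proof.
move=> /edge_idealP[c ->]; apply/edge_idealP; exists (fun i j => a * c i j).
rewrite mulr_sumr; apply: eq_bigr => i _.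
by rewrite mulr_sumr; apply: eq_bigr => j _; rewrite mulrA.
Qed.

Fact edge_ideal_submod_closed : submod_closed edge_ideal.
Proof.
split=> [|a u v uI vI]; first exact: edge_ideal0.
exact: edge_idealD (edge_idealM a uI) vI.
Qed.

HB.instance Definition _ :=
  GRing.isSubmodClosed.Build S S^o edge_ideal edge_ideal_submod_closed.

(* The grading of S: S_a = K x^a for a >= 0, and 0 otherwise. *)
Definition mpoly_comp (a : 'rV[int]_n) (p : S) : Prop :=
  forall m, m \in msupp p -> mdegZ m = a.

Lemma mpoly_comp_term (c : K) m : mpoly_comp (mdegZ m) (c *: 'X_[m]).
Proof. by move=> m' /msuppZ_le; rewrite msuppX inE => /eqP ->. Qed.

Lemma mpoly_comp0 a : mpoly_comp a 0.
Proof. by move=> m; rewrite msupp0. Qed.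

Lemma mpoly_compD a p q :
  mpoly_comp a p -> mpoly_comp a q -> mpoly_comp a (p + q).
Proof.
by move=> pa qa m /msuppD_le; rewrite mem_cat => /orP[/pa|/qa].
Qed.

Lemma mpoly_compZ a c p : mpoly_comp a p -> mpoly_comp a (c%:MP * p).
Proof. by rewrite mul_mpolyC => pa m /msuppZ_le/pa. Qed.

Lemma mdegZD (m m' : 'X_{1..n}) : mdegZ (m + m') = mdegZ m + mdegZ m'.
Proof. by apply/rowP => i; rewrite !mxE mnmDE. Qed.

Lemma mpoly_compX a m p :
  mpoly_comp a p -> mpoly_comp (mdegZ m + a) ('X_[m] * p).
Proof.
move=> pa m'; rewrite mulrC (perm_mem (msuppMX _ _)) => /mapP[m1 /pa <- ->].
by rewrite addrC -mdegZD addmC.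
Qed.

Lemma mpoly_comp_coeff (s : seq 'rV[int]_n) (f : 'rV[int]_n -> S) a m :
  uniq s -> (forall a, mpoly_comp a (f a)) -> a \in s -> m \in msupp (f a) ->
  (\sum_(b <- s) f b)@_m = (f a)@_m.
Proof.
move=> us fc sa ma; rewrite raddf_sum (bigD1_seq a) //= big1 ?addr0 // => b ba.
apply: memN_msupp_eq0; apply: contra ba => /fc <-.
by rewrite (fc _ _ ma).
Qed.

Lemma edge_ideal_term (p : S) m :
  p \in edge_ideal -> p@_m *: 'X_[m] \in edge_ideal.
Proof.
move=> /edge_idealP[c ->]; apply/edge_idealP.
exists (fun i j => if (U_(i) + U_(j) <= m)%MM
          then (c i j)@_(m - (U_(i) + U_(j))) *: 'X_[m - (U_(i) + U_(j))]
          else 0).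
rewrite raddf_sum scaler_suml; apply: eq_bigr => i _.
rewrite raddf_sum scaler_suml; apply: eq_bigr => j _ /=.
rewrite -mpolyXD; case: ifP => le_m.
  rewrite -scalerAl -mpolyXD submK //; congr (_ *: _).
  by rewrite -[in LHS](submK le_m) addmC mcoeffMX.
rewrite mul0r memN_msupp_eq0 ?scale0r // (perm_mem (msuppMX _ _)).
apply/mapP => -[m' _ mE]; move: le_m; rewrite mE.
by rewrite lem_addr.
Qed.

Lemma edge_ideal_edge i j : e i j -> 'X_i * 'X_j \in edge_ideal.
Proof.
move=> eij; apply/edge_idealP.
exists (fun i' j' => ((i' == i) && (j' == j))%:R).
rewrite (bigD1 i) //= (bigD1 j) //= !eqxx mul1r !big1 ?addr0 //.
  by move=> i' /negPf ->; rewrite big1 // => j' _; rewrite mul0r.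
by move=> j' /andP[_ /negPf ->]; rewrite andbF mul0r.
Qed.

Record edge_ideal_sub := EdgeIdealSub {
  edge_ideal_val :> S^o;
  edge_ideal_valP : edge_ideal_val \in edge_ideal
}.

HB.instance Definition _ := [isSub for edge_ideal_val].
HB.instance Definition _ := [Choice of edge_ideal_sub by <:].
HB.instance Definition _ := [SubChoice_isSubLmodule of edge_ideal_sub by <:].

(* S/I as an S-module, with the scaling defined through representatives. *)
Definition edge_quot := {ideal_quot edge_ideal}.

HB.instance Definition _ := GRing.Zmodule.on edge_quot.

Definition edge_pi (p : S) : edge_quot := \pi_{ideal_quot edge_ideal} p.

Lemma edge_pi_surj (q : edge_quot) : exists p, q = edge_pi p.
Proof. by exists (repr q); rewrite /edge_pi reprK. Qed.

Lemma edge_pi_eqP (p q : S) : reflect (edge_pi p = edge_pi q) (p - q \in edge_ideal).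
Proof. by rewrite [_ \in _]Quotient.idealrBE; apply: eqP. Qed.

Lemma edge_piD : {morph edge_pi : p q / p + q}.
Proof. by move=> p q; rewrite /edge_pi -raddfD. Qed.

Lemma edge_pi0 : edge_pi 0 = 0.
Proof. by apply: (addIr (edge_pi 0)); rewrite -edge_piD !add0r. Qed.

Lemma edge_pi_sum (T : Type) (s : seq T) (F : T -> S) :
  edge_pi (\sum_(t <- s) F t) = \sum_(t <- s) edge_pi (F t).
Proof. exact: (big_morph _ edge_piD edge_pi0). Qed.

Definition edge_quot_scale (a : S) (q : edge_quot) : edge_quot :=
  edge_pi (a * repr q).

Lemma edge_quot_scaleE a p : edge_quot_scale a (edge_pi p) = edge_pi (a * p).
Proof.
apply/edge_pi_eqP; rewrite -mulrBr edge_idealM //.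
by apply/edge_pi_eqP; rewrite {1}/edge_pi reprK.
Qed.

Fact edge_quot_scaleA a b q :
  edge_quot_scale a (edge_quot_scale b q) = edge_quot_scale (a * b) q.
Proof. by have [p ->] := edge_pi_surj q; rewrite !edge_quot_scaleE mulrA. Qed.

Fact edge_quot_scale1 : left_id 1 edge_quot_scale.
Proof.
by move=> q; have [p ->] := edge_pi_surj q; rewrite edge_quot_scaleE mul1r.
Qed.

Fact edge_quot_scaleDr : right_distributive edge_quot_scale +%R.
Proof.
move=> a q r; have [p ->] := edge_pi_surj q; have [p' ->] := edge_pi_surj r.
by rewrite -edge_piD !edge_quot_scaleE mulrDr edge_piD.
Qed.

Fact edge_quot_scaleDl q : {morph edge_quot_scale^~ q : a b / a + b}.
Proof.
move=> a b; have [p ->] := edge_pi_surj q.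
by rewrite !edge_quot_scaleE mulrDl edge_piD.
Qed.

HB.instance Definition _ := GRing.Zmodule_isLmodule.Build S edge_quot
  edge_quot_scaleA edge_quot_scale1 edge_quot_scaleDr edge_quot_scaleDl.

Lemma edge_piZ (a p : S) : a *: edge_pi p = edge_pi (a * p).
Proof. exact: edge_quot_scaleE. Qed.

Definition edge_ideal_comp a (u : edge_ideal_sub) : Prop :=
  mpoly_comp a (edge_ideal_val u).

Fact edge_ideal_span (v : edge_ideal_sub) : exists2 s : seq edge_ideal_sub,
  (forall u, u \in s -> exists a, edge_ideal_comp a u) & v = \sum_(u <- s) u.
Proof.
pose F m := EdgeIdealSub (edge_ideal_term m (edge_ideal_valP v)).
exists [seq F m | m <- msupp (edge_ideal_val v : S)].
  by move=> u /mapP[m _ ->]; exists (mdegZ m); apply: mpoly_comp_term.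
apply: val_inj; rewrite big_map raddf_sum /=.
exact: mpolyE.
Qed.

Fact edge_ideal_indep (s : seq 'rV[int]_n) (f : 'rV[int]_n -> edge_ideal_sub) :
  uniq s -> (forall a, edge_ideal_comp a (f a)) ->
  \sum_(a <- s) f a = 0 -> forall a, a \in s -> f a = 0.
Proof.
move=> us fc f0 a sa; apply: val_inj; apply: msuppnil0.
have {}f0 : \sum_(b <- s) (edge_ideal_val (f b) : S) = 0.
  have := congr1 edge_ideal_val f0.
  by rewrite [LHS](raddf_sum (val : edge_ideal_sub -> S^o)).
case E: msupp => [//|m t].
have ma : m \in msupp (edge_ideal_val (f a) : S) by rewrite E mem_head.
have := mpoly_comp_coeff us fc sa ma; rewrite f0 mcoeff0 => /esym/eqP.
by rewrite mcoeff_eq0 ma.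
Qed.

Fact edge_ideal_fg : exists (r : nat) (g : 'I_r -> edge_ideal_sub),
  forall v, exists c : 'I_r -> S, v = \sum_i c i *: g i.
Proof.
pose T : finType := ('I_n * 'I_n)%type.
pose g (x : T) : edge_ideal_sub := insubd 0 ('X_x.1 * 'X_x.2 : S^o).
exists #|T|, (fun i => g (enum_val i)) => v.
have /edge_idealP[c vE] := edge_ideal_valP v.
pose d (x : T) := if e x.1 x.2 then c x.1 x.2 else 0.
exists (fun i => d (enum_val i)).
rewrite -(big_enum_val (fun x => d x *: g x)) /=.
apply: val_inj; rewrite raddf_sum /= [LHS]vE pair_big_dep /=.
rewrite [LHS]big_mkcond; apply: eq_bigr => x _ /=; rewrite /d.
case: ifP => ex; last by rewrite scale0r.
by rewrite /g [_ *: _]/(_ *: _) /= val_insubd edge_ideal_edge.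
Qed.

Definition edge_ideal_module : gradedModule K n :=
  @GradedModule K n edge_ideal_sub edge_ideal_comp
    (fun a => mpoly_comp0 a)
    (fun a u v ua va => mpoly_compD ua va)
    (fun a c u ua => mpoly_compZ (c := c) ua)
    (fun a m u ua => mpoly_compX (m := m) ua)
    edge_ideal_span edge_ideal_indep edge_ideal_fg.

(* The grading of S/I: the image of the grading of S. *)
Definition edge_quot_comp a (q : edge_quot) : Prop :=
  exists2 p, mpoly_comp a p & q = edge_pi p.

Fact edge_quot_span (v : edge_quot) : exists2 s : seq edge_quot,
  (forall u, u \in s -> exists a, edge_quot_comp a u) & v = \sum_(u <- s) u.
Proof.
have [p ->] := edge_pi_surj v.
exists [seq edge_pi (p@_m *: 'X_[m]) | m <- msupp p].
  move=> u /mapP[m _ ->]; exists (mdegZ m), (p@_m *: 'X_[m]) => //.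
  exact: mpoly_comp_term.
by rewrite big_map -edge_pi_sum -mpolyE.
Qed.

Fact edge_quot_indep (s : seq 'rV[int]_n) (f : 'rV[int]_n -> edge_quot) :
  uniq s -> (forall a, edge_quot_comp a (f a)) ->
  \sum_(a <- s) f a = 0 -> forall a, a \in s -> f a = 0.
Proof.
move=> us fc f0 a sa.
have {fc}/choice[p pP] : forall b, exists p, mpoly_comp b p /\ f b = edge_pi p.
  by move=> b; have [p] := fc b; exists p.
have pc b : mpoly_comp b (p b) by have [] := pP b.
have {}f0 : \sum_(b <- s) p b \in edge_ideal.
  rewrite -[X in X \in _]subr0; apply/edge_pi_eqP.
  rewrite edge_pi_sum edge_pi0 -[RHS]f0.
  by apply: eq_bigr => b _; have [] := pP b.
have [_ ->] := pP a; rewrite -edge_pi0; apply/edge_pi_eqP; rewrite subr0.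
rewrite (mpolyE (p a)) big_seq.
apply: (big_ind (fun q : S => q \in edge_ideal)) => [||m ma].
- exact: edge_ideal0.
- exact: edge_idealD.
- by rewrite -(mpoly_comp_coeff us pc sa ma); apply: edge_ideal_term.
Qed.

Fact edge_quot_fg : exists (r : nat) (g : 'I_r -> edge_quot),
  forall v, exists c : 'I_r -> S, v = \sum_i c i *: g i.
Proof.
exists 1%N, (fun _ => edge_pi 1) => v; have [p ->] := edge_pi_surj v.
by exists (fun _ => p); rewrite big_ord1 edge_piZ mulr1.
Qed.

Fact edge_quot_comp0 a : edge_quot_comp a 0.
Proof. by exists 0; [apply: mpoly_comp0 | rewrite edge_pi0]. Qed.

Fact edge_quot_compD a u v :
  edge_quot_comp a u -> edge_quot_comp a v -> edge_quot_comp a (u + v).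
Proof.
move=> [p pa ->] [q qa ->].
by exists (p + q); [apply: mpoly_compD | rewrite edge_piD].
Qed.

Fact edge_quot_compZ a (c : K) u :
  edge_quot_comp a u -> edge_quot_comp a (c%:MP *: u).
Proof.
move=> [p pa ->].
by exists (c%:MP * p); [apply: mpoly_compZ | rewrite edge_piZ].
Qed.

Fact edge_quot_compX a (m : 'X_{1..n}) u :
  edge_quot_comp a u -> edge_quot_comp (mdegZ m + a) ('X_[m] *: u).
Proof.
move=> [p pa ->].
by exists ('X_[m] * p); [apply: mpoly_compX | rewrite edge_piZ].
Qed.

Definition edge_quot_module : gradedModule K n :=
  @GradedModule K n edge_quot edge_quot_comp
    edge_quot_comp0 edge_quot_compD edge_quot_compZ edge_quot_compX
    edge_quot_span edge_quot_indep edge_quot_fg.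

End EdgeIdeal.

(* Main.v *)
Require Import Defs.
From mathcomp Require Import all_boot all_order all_algebra.
From mathcomp Require Import mpoly.
From mathcomp Require Import boolp zify.

(* Partition the squarefree monomials of I (resp. of S/I), i.e. the dependent
   (resp. independent) vertex sets, into intervals [A, B]; the Stanley spaces
   x^A K[B] then decompose I (resp. S/I), so the least |B| bounds the Stanley
   depth from below.

   Call V good for d if its independent sets have such a partition with tops of
   size >= d and its dependent sets one with tops of size >= d + 1. Splitting
   on a non-isolated vertex v, V is good for d as soon as V - v is good for d
   and V - N[v] for d - 1: a dependent set containing v either stays dependent
   in V - N[v] or meets N(v). Choosing v next to a simplicial vertex, chordal
   graphs are good for the least size of a maximal independent set. Deleting the
   last k vertices of C_n^k one by one in this way leaves a power of a path.
   Since closed neighbourhoods have at most 2k + 1 elements, one gets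
   sdepth I >= ceil((n - k) / (2k + 1)) + 1. Conversely the Stanley space of
   x^A, for A a maximal independent set, only has variables in A, and there is
   such an A with ceil(n / (2k + 1)) elements. *)

Set Implicit Arguments.
Unset Strict Implicit.
Unset Printing Implicit Defensive.

(** * Partitions of set families into intervals *)

Section IntervalPartition.
Variable T : finType.
Implicit Types (A B C X Y : {set T}) (F G : pred {set T}) (L : {set T} * {set T}).
Implicit Type s : seq ({set T} * {set T}).

Definition between L C := (L.1 \subset C) && (C \subset L.2).

(** With [F C] read as 0 or 1, the single count makes the intervals of [s] disjoint, lets them cover
    [F] and keeps them inside [F]. *)
Definition interval_partition F d s :=
  (forall C, count (between^~ C) s = F C) /\
  {in s, forall L, L.1 \subset L.2 /\ d <= #|L.2|}.

Definition partitionable F d := exists s, interval_partition F d s.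

Lemma interval_partition_sub F d s L C :
  interval_partition F d s -> L \in s -> between L C -> F C.
Proof.
move=> [cs _] Ls IC; case FC: (F C) => //.
have : has (between^~ C) s by apply/hasP; exists L.
by rewrite has_count cs FC.
Qed.

Lemma interval_partition_top F d s L :
  interval_partition F d s -> L \in s -> F L.2.
Proof.
move=> ps Ls; apply: (interval_partition_sub ps Ls).
by have [_ /(_ L Ls)[ss _]] := ps; rewrite /between ss /=.
Qed.

Lemma interval_partition_bottom F d s L :
  interval_partition F d s -> L \in s -> F L.1.
Proof.
move=> ps Ls; apply: (interval_partition_sub ps Ls).
by have [_ /(_ L Ls)[ss _]] := ps; rewrite /between ss andbT.
Qed.

Lemma eq_partitionable F G d : F =1 G -> partitionable F d -> partitionable G d.
Proof. by move=> FG [s [cs ts]]; exists s; split=> // C; rewrite cs FG. Qed.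

Lemma leq_partitionable F d d' :
  d' <= d -> partitionable F d -> partitionable F d'.
Proof.
move=> le_d [s [cs ts]]; exists s; split=> // L /ts[sI dI].
by split=> //; apply: leq_trans dI.
Qed.

Lemma partitionable_interval A B :
  A \subset B -> partitionable (between (A, B)) #|B|.
Proof.
move=> sAB; exists [:: (A, B)]; split=> [C|L]; first by rewrite /= addn0.
by rewrite inE => /eqP ->.
Qed.

Lemma partitionable_points F d :
  (forall C, F C -> d <= #|C|) -> partitionable F d.
Proof.
move=> Fd; exists [seq (C, C) | C <- enum F]; split=> [C|L].
  rewrite count_map (eq_count (a2 := pred1 C)) => [|C' /=].
    by rewrite count_uniq_mem ?enum_uniq // mem_enum.
  by rewrite /between /= eqEsubset.
by move=> /mapP[C]; rewrite mem_enum => /Fd dC ->.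
Qed.

Lemma partitionableU F G d : (forall C, F C -> ~~ G C) ->
  partitionable F d -> partitionable G d ->
  partitionable (fun C => F C || G C) d.
Proof.
move=> FG [s [cs ts]] [t [ct tt]]; exists (s ++ t); split=> [C|L].
  rewrite count_cat cs ct; have := FG C.
  by case: (F C) => [/(_ isT)/negPf->|_]; case: (G C).
by rewrite mem_cat => /orP[/ts|/tt].
Qed.

Lemma count_allpairs (S1 S2 S3 : eqType) (f : S1 -> S2 -> S3)
    (s : seq S1) (t : seq S2) (a : pred S1) (b : pred S2) (q : pred S3) :
    (forall x y, x \in s -> y \in t -> q (f x y) = a x && b y) ->
  count q [seq f x y | x <- s, y <- t] = count a s * count b t.
Proof.
elim: s => //= x s IHs qab; rewrite count_cat IHs => [|y z ys zt]; last first.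
  by rewrite qab // inE ys orbT.
rewrite mulnDl count_map; congr (_ + _).
rewrite (eq_in_count (a2 := fun y => a x && b y)) => [|y yt]; last first.
  by rewrite /= qab // mem_head.
by case: (a x); rewrite ?mul1n ?mul0n //= count_pred0.
Qed.

(** Over disjoint ground sets a product of intervals is an interval: bottoms and tops are united,
    and the sizes of the tops add up. *)
Lemma partitionableX X Y F G c d : [disjoint X & Y] ->
  (forall C, F C -> C \subset X) -> (forall C, G C -> C \subset Y) ->
  partitionable F c -> partitionable G d ->
  partitionable
    (fun C => [&& C \subset X :|: Y, F (C :&: X) & G (C :&: Y)]) (c + d).
Proof.
move=> dXY FX GY [s ps] [t pt].
have topX (L : {set T} * {set T}) : L \in s -> L.2 \subset X by move=> /(interval_partition_top ps)/FX.
have topY (J : {set T} * {set T}) : J \in t -> J.2 \subset Y by move=> /(interval_partition_top pt)/GY.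
have sub_s (L : {set T} * {set T}) : L \in s -> L.1 \subset L.2 by have [_ h] := ps; case/h.
have sub_t (J : {set T} * {set T}) : J \in t -> J.1 \subset J.2 by have [_ h] := pt; case/h.
exists [seq (L.1 :|: J.1, L.2 :|: J.2) | L <- s, J <- t]; split=> [C|K].
  transitivity (count (fun L => (C \subset X :|: Y) && between L (C :&: X)) s
    * count (between^~ (C :&: Y)) t); last first.
    have [[cs _] [ct _]] := (ps, pt); rewrite ct.
    case: (C \subset X :|: Y) => /=; last by rewrite count_pred0.
    by rewrite cs; case: (F (C :&: X)); case: (G (C :&: Y)).
  apply: count_allpairs => L J Ls Jt.
  have [IX JY] := (topX L Ls, topY J Jt).
  have [I1X J1Y] := (subset_trans (sub_s L Ls) IX, subset_trans (sub_t J Jt) JY).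
  rewrite /between /= subUset !subsetI I1X J1Y !andbT.
  have dis z : z \in X -> z \notin Y by move=> zX; rewrite (disjointFr dXY zX).
  apply/andP/andP.
    move=> [/andP[-> ->] sC]; rewrite (subset_trans sC (setUSS IX JY)) /=.
    split; apply/subsetP => z; rewrite inE => /andP[/(subsetP sC)].
      by rewrite inE => /orP[//|/(subsetP JY) zY /dis]; rewrite zY.
    by rewrite inE => /orP[/(subsetP IX)/dis/negPf->|].
  move=> [/andP[sC /andP[-> sX]] /andP[-> sY]]; split=> //.
  apply/subsetP => z zC; have := subsetP sC z zC; rewrite !inE => /orP[zX|zY].
    by rewrite (subsetP sX) // inE zC.
  by rewrite (subsetP sY) ?orbT // inE zC.
move=> /allpairsP[[L J] /= [Ls Jt ->]] /=.
split; first by apply: setUSS; [apply: sub_s | apply: sub_t].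
have dIJ := disjointWl (topX L Ls) (disjointWr (topY J Jt) dXY).
rewrite cardsU (disjoint_setI0 dIJ) cards0 subn0.
by have [_ /(_ L Ls)[_ cI]] := ps; have [_ /(_ J Jt)[_ cJ]] := pt; apply: leq_add.
Qed.

(** The vertex [v] is added to both ends of every interval. *)
Lemma partitionable_cone v F d : (forall C, F C -> v \notin C) ->
  partitionable F d -> partitionable (fun C => (v \in C) && F (C :\ v)) d.+1.
Proof.
move=> Fv [s ps]; have [cs ts] := ps.
exists [seq (v |: L.1, v |: L.2) | L <- s]; split=> [C|K].
  rewrite count_map; case: (boolP (v \in C)) => vC /=; last first.
    rewrite (eq_count (a2 := pred0)) ?count_pred0 // => L /=.
    by rewrite /between /= subUset sub1set (negPf vC).
  rewrite -cs; apply: eq_in_count => L Ls /=; rewrite /between /= subUset sub1set vC.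
  by rewrite subsetD1 (Fv _ (interval_partition_bottom ps Ls)) andbT subDset.
move=> /mapP[L Ls ->]; have [sI dI] := ts L Ls; split; first exact: setUS.
by rewrite cardsU1 (Fv _ (interval_partition_top ps Ls)).
Qed.

(** Here [v] is added to the tops only, which makes it a free element of every interval. *)
Lemma partitionable_join v F d : (forall C, F C -> v \notin C) ->
  partitionable F d -> partitionable (fun C => F (C :\ v)) d.+1.
Proof.
move=> Fv [s ps]; have [cs ts] := ps.
exists [seq (L.1, v |: L.2) | L <- s]; split=> [C|K].
  rewrite count_map -cs; apply: eq_in_count => L Ls; rewrite /between /=.
  by rewrite subsetD1 (Fv _ (interval_partition_bottom ps Ls)) andbT subDset.
move=> /mapP[L Ls ->]; have [sI dI] := ts L Ls; split=> /=.
  exact: subset_trans sI (subsetUr _ _).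
by rewrite cardsU1 (Fv _ (interval_partition_top ps Ls)).
Qed.

End IntervalPartition.

(** * Independent and dependent vertex sets of a graph *)

Section Independence.
Variables (T : finType) (e : rel T).
Hypotheses (e_sym : ssrbool.symmetric e) (e_irr : irreflexive e).
Implicit Types (A C D U V : {set T}).

Definition dependent C := [exists i in C, [exists j in C, e i j]].

Lemma dependentP C :
  reflect (exists i j, [/\ i \in C, j \in C & e i j]) (dependent C).
Proof.
apply: (iffP exists_inP) => [[i iC /exists_inP[j jC eij]]|[i [j [iC jC eij]]]].
  by exists i, j.
by exists i => //; apply/exists_inP; exists j.
Qed.

Lemma dependent_sub A C : A \subset C -> dependent A -> dependent C.
Proof.
move=> /subsetP sAC /dependentP[i [j [iA jA eij]]].
by apply/dependentP; exists i, j; rewrite !sAC.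
Qed.

Definition indep_sets V C := (C \subset V) && ~~ dependent C.
Definition dep_sets V C := (C \subset V) && dependent C.

Definition nbrs V v := [set w in V | e v w].
Definition non_nbrs V v := [set w in V :\ v | ~~ e v w].

Definition dominating V A := forall v, v \in V -> v \notin A ->
  exists2 a, a \in A & e v a.

(** An independent set is dominating exactly when it is maximal, so [d] is a lower bound for the
    independent domination number of the graph induced on [V]. *)
Definition indep_dom_ge V d := forall A,
  indep_sets V A -> dominating V A -> d <= #|A|.

Definition good V d :=
  partitionable (indep_sets V) d /\ partitionable (dep_sets V) d.+1.

Lemma good0 V : good V 0.
Proof.
split; apply: partitionable_points => // C /andP[_ /dependentP[i [j [iC _ _]]]].
by apply/card_gt0P; exists i.
Qed.

Lemma indep_sets_notin V v C : indep_sets (V :\ v) C -> v \notin C.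
Proof. by case/andP; rewrite subsetD1 => /andP[]. Qed.

Lemma dep_sets_notin V v C : dep_sets (V :\ v) C -> v \notin C.
Proof. by case/andP; rewrite subsetD1 => /andP[]. Qed.

Lemma non_nbrs_notin V v C : C \subset non_nbrs V v -> v \notin C.
Proof. by move=> /subsetP sC; apply/negP => /sC; rewrite !inE eqxx. Qed.

Lemma dependent_add V v D : D \subset non_nbrs V v ->
  dependent (v |: D) = dependent D.
Proof.
move=> /subsetP sD; apply/idP/idP; last exact: dependent_sub (subsetUr _ _).
have nv i : i \in D -> ~~ e v i by move=> /sD; rewrite !inE => /andP[].
move=> /dependentP[i [j []]]; rewrite !inE.
move=> /predU1P[->|iD] /predU1P[->|jD] eij; last by apply/dependentP; exists i, j.
- by rewrite e_irr in eij.
- by have := nv _ jD; rewrite eij.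
- by have := nv _ iD; rewrite e_sym eij.
Qed.

(** Independent sets avoiding [v] are those of V - v; deleting [v] from the others gives exactly the
    independent sets of V - N[v], over which one takes a cone. *)
Lemma shed_indep V v d : v \in V ->
  partitionable (indep_sets (V :\ v)) d ->
  partitionable (indep_sets (non_nbrs V v)) d.-1 ->
  partitionable (indep_sets V) d.
Proof.
move=> vV pV pU.
have Uv C : indep_sets (non_nbrs V v) C -> v \notin C.
  by move=> /andP[/non_nbrs_notin].
have := leq_partitionable (leqSpred d) (partitionable_cone Uv pU).
move=> /(partitionableU _ pV) pVU; apply: eq_partitionable (pVU _) => C; last first.
  by move=> /indep_sets_notin/negPf ->.
rewrite /indep_sets subsetD1; case: (boolP (v \in C)) => vC /=; last first.
  by rewrite andbT orbF.
rewrite andbF /=; apply/andP/andP => [[sC iC]|[sC iC]]; last first.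
  split; last by apply: contra iC; apply: dependent_sub (subsetDl _ _).
  apply/subsetP => w; rewrite !inE => /andP[-> wC]; rewrite (subsetP sC) //=.
  by apply: contra iC => evw; apply/dependentP; exists v, w.
split; last by rewrite -(setD1K vC) (dependent_add sC).
rewrite -(setD1K vC) subUset sub1set vV; apply: subset_trans sC _.
by apply/subsetP => w; rewrite !inE => /andP[/andP[]].
Qed.

(** Let U = V - N[v] and N = N(v). A dependent set containing [v] either has a dependent trace on U
    and any trace on N, or an independent trace on U and a nonempty trace on N. Both families are
    products with a cone over [v]. *)
Lemma shed_dep V v w d : v \in V -> w \in V -> e v w ->
  partitionable (dep_sets (V :\ v)) d.+1 ->
  good (non_nbrs V v) d.-1 ->
  partitionable (dep_sets V) d.+1.
Proof.
move=> vV wV evw pV [pUi pUd]; set U := non_nbrs V v in pUi pUd.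
pose N := nbrs V v.
have dUN : [disjoint U & N].
  by apply/pred0P => z; rewrite /= !inE; case: (e v z); rewrite ?andbF.
have defV : U :|: N = V :\ v.
  apply/setP => z; rewrite !inE; case: eqVneq => [->|] /=.
    by rewrite e_irr andbF.
  by case: (z \in V) (e v z) => [] [].
have N1 : 0 < #|N| by apply/card_gt0P; exists w; rewrite inE wV.
have pN : partitionable (between (set0, N)) 1.
  by apply: leq_partitionable N1 (partitionable_interval _); apply: sub0set.
pose pN1F C := (C != set0) && (C \subset N).
have pN1 : partitionable pN1F 1.
  by apply: partitionable_points => C /andP[]; rewrite -card_gt0.
have p1 := partitionableX (F := dep_sets U) dUN (fun C h => proj1 (andP h))
  (fun C h => proj2 (andP h)) pUd pN.
(* The nonempty trace on N supplies the unit by which the bound for independent sets of U is below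
   the one for dependent sets. *)
have p2 := partitionableX (F := indep_sets U) dUN (fun C h => proj1 (andP h))
  (fun C h => proj2 (andP h)) pUi pN1.
rewrite addn1 in p2; have {}p1 := leq_partitionable (leq_addr 1 _) p1.
pose F1 C := [&& C \subset U :|: N, dep_sets U (C :&: U) & between (set0, N) (C :&: N)].
pose F2 C := [&& C \subset U :|: N, indep_sets U (C :&: U) & pN1F (C :&: N)].
have F1F2 C : F1 C -> ~~ F2 C.
  move=> /and3P[_ /andP[_ dC] _]; apply/negP => /and3P[_ /andP[_]].
  by rewrite dC.
have Fv C : F1 C || F2 C -> v \notin C.
  by rewrite /F1 /F2 defV => /orP[] /andP[]; rewrite subsetD1 => /andP[].
have le_d : d.+1 <= d.-1.+2 by rewrite ltnS leqSpred.
have p3 := leq_partitionable le_d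
  (partitionable_cone Fv (partitionableU F1F2 p1 p2)).
apply: eq_partitionable (partitionableU _ pV p3) => C; last first.
  by move=> /dep_sets_notin/negPf ->.
apply/esym; rewrite {1 2}/dep_sets subsetD1; case: (boolP (v \in C)) => vC /=; last first.
    by rewrite andbT orbF.
  rewrite andbF /F1 /F2 /pN1F /= !defV /between /= sub0set subsetIr andbT.
  rewrite /dep_sets /indep_sets !subsetIr /= andbT.
  have -> : (C :\ v \subset V :\ v) = (C \subset V).
    rewrite subsetD1 !inE eqxx /= andbT subDset.
    by apply/idP/idP => [|/subset_trans->//]; rewrite ?subsetUr // (setUidPr _) ?sub1set.
  case: (boolP (C \subset V)) => //= sC.
  case: (boolP (dependent ((C :\ v) :&: U))) => dC /=.
    by apply: dependent_sub dC; apply: subset_trans (subsetIl _ _) (subsetDl _ _).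
  case: eqVneq => [CN|/set0Pn[z]] /=; last first.
    rewrite !inE => /andP[/andP[_ zC] /andP[_ evz]].
    by apply/dependentP; exists v, z.
  (* If C contains no neighbour of [v], then C - v lies in U, and it is dependent as soon as C
     is. *)
  apply: contraNF dC; rewrite -{1}(setD1K vC) => dC.
  suff sCU : C :\ v \subset U by rewrite (setIidPl sCU) -(dependent_add sCU).
  apply/subsetP => z zC; have : z \notin N.
    by apply/negP => zN; have := in_set0 z; rewrite -CN inE zC zN.
  move: zC; rewrite !inE => /andP[-> zC]; by rewrite (subsetP sC).
Qed.

Lemma shed_good V v w d : v \in V -> w \in V -> e v w ->
  good (V :\ v) d -> good (non_nbrs V v) d.-1 -> good V d.
Proof.
move=> vV wV evw [pVi pVd] gU; split; last exact: shed_dep evw pVd gU.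
by apply: shed_indep vV pVi _; case: gU.
Qed.

(** An isolated vertex does not affect dependence, so it can join the top of every interval. *)
Lemma isolated_good V v d : v \in V -> {in V, forall w, ~~ e v w} ->
  good (V :\ v) d.-1 -> good V d.
Proof.
move=> vV nV [pi pd].
have {}pi := partitionable_join (@indep_sets_notin V v) pi.
have {}pd := partitionable_join (@dep_sets_notin V v) pd.
have VU : V :\ v = non_nbrs V v.
  by apply/setP => w; rewrite !inE; case: (boolP (w \in V)) => [/nV->|]; rewrite ?andbT ?andbF.
have sub C : (C :\ v \subset V :\ v) = (C \subset V).
  rewrite subsetD1 !inE eqxx /= andbT subDset.
  by rewrite (setUidPr _) ?sub1set.
have dep C : C \subset V -> dependent (C :\ v) = dependent C.
  rewrite -sub; case: (boolP (v \in C)) => vC; last first.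
    by rewrite (setDidPl _) // disjoint_sym disjoints1.
  by rewrite VU => sC; rewrite -[in RHS](setD1K vC) (dependent_add sC).
split.
  apply: eq_partitionable (leq_partitionable (leqSpred d) pi) => C.
  by rewrite /indep_sets sub; case: (boolP (C \subset V)) => //= /dep ->.
have le_d : d.+1 <= d.-1.+2 by rewrite ltnS leqSpred.
apply: eq_partitionable (leq_partitionable le_d pd) => C.
by rewrite /dep_sets sub; case: (boolP (C \subset V)) => //= /dep ->.
Qed.

(** Adding [v] to a maximal independent set of V - N[v] gives one of V. *)
Lemma indep_dom_ge_non_nbrs V v d : v \in V ->
  indep_dom_ge V d -> indep_dom_ge (non_nbrs V v) d.-1.
Proof.
move=> vV Vd A /andP[sA iA] domA.
have vA := non_nbrs_notin sA.
suff : d <= #|v |: A| by rewrite cardsU1 vA; case: d {Vd}.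
apply: Vd.
  apply/andP; split; last by rewrite (dependent_add sA).
  rewrite subUset sub1set vV; apply: subset_trans sA _.
  by apply/subsetP => w; rewrite !inE => /andP[/andP[]].
move=> w wV; rewrite !inE negb_or => /andP[wv wA].
case: (boolP (e v w)) => evw; first by exists v; rewrite ?setU11 // e_sym.
have wU : w \in non_nbrs V v by rewrite !inE wv wV.
by have [a aA ewa] := domA w wU wA; exists a; rewrite // setU1r.
Qed.

(* A maximal independent set of V :\ v meets the closed neighbourhood of u in
   V :\ v, hence the neighbourhood of v: it is still maximal in V. *)
Lemma indep_dom_ge_shed V u v d : u \in V -> e v u ->
  {in V, forall w, e u w -> w != v -> e v w} ->
  indep_dom_ge V d -> indep_dom_ge (V :\ v) d.
Proof.
move=> uV evu dom Vd A /andP[sA iA] domA.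
have [sAV vA] := subsetD1P sA.
apply: Vd; first by rewrite /indep_sets sAV.
move=> w wV wA; case: (eqVneq w v) => [->|wv]; last first.
  by apply: domA => //; rewrite !inE wv.
have uv : u != v by apply: contraTneq evu => ->; rewrite e_irr.
case: (boolP (u \in A)) => uA; first by exists u.
have [|a aA eua] := domA u _ uA; first by rewrite !inE uv.
exists a => //; apply: dom => //; first exact: (subsetP sAV).
by apply: contraNneq vA => <-.
Qed.

(** Chordality of the graph induced on [U], stated as the existence of a simplicial vertex in each
    nonempty induced subgraph; this form passes to subsets. *)
Definition chordal_on U := forall V, V \subset U -> V != set0 ->
  exists2 u, u \in V &
    {in V &, forall v w, e u v -> e u w -> v != w -> e v w}.

(** Induction on the size of [V]. If the simplicial vertex [u] has a neighbour [v] in [V], then [v]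
    is adjacent to all other neighbours of [u], and shedding [v] keeps the bound; otherwise [u] is
    isolated. *)
Lemma chordal_good U V d :
  chordal_on U -> V \subset U -> indep_dom_ge V d -> good V d.
Proof.
move=> chU; have [m] := ubnP #|V|; elim: m V d => // m IHm V d.
rewrite ltnS => leVm sVU Vd.
case: (eqVneq V set0) => [V0|Vn0].
  have : d <= #|(set0 : {set T})|.
    apply: Vd => [|v]; last by rewrite V0 inE.
    apply/andP; split; first exact: sub0set.
    by apply/dependentP => -[i [j []]]; rewrite inE.
  by rewrite cards0 leqn0 => /eqP ->; apply: good0.
have [u uV simp] := chU V sVU Vn0.
have cardD v : v \in V -> #|V :\ v| < m.
  by move=> vV; rewrite (leq_trans _ leVm) // [X in _ < X](cardsD1 v) vV.
have subD v : V :\ v \subset U by apply: subset_trans sVU; apply: subsetDl.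
have sUD v : non_nbrs V v \subset V :\ v.
  by apply/subsetP => w; rewrite !inE => /andP[].
case: (boolP [exists v in V, e u v]) => [/exists_inP[v vV euv]|/exists_inPn nu].
  have evu : e v u by rewrite e_sym.
  apply: (shed_good vV uV evu).
    apply: IHm; [exact: cardD|exact: subD|].
    apply: (indep_dom_ge_shed uV evu _ Vd) => w wV euw wv.
    by apply: (simp v w) => //; rewrite eq_sym.
  apply: IHm; last exact: indep_dom_ge_non_nbrs.
    by apply: leq_ltn_trans (subset_leq_card (sUD v)) (cardD v vV).
  exact: subset_trans (sUD v) (subD v).
have nuV : {in V, forall w, ~~ e u w} by move=> w /nu.
apply: (isolated_good uV nuV).
have -> : V :\ u = non_nbrs V u.
  by apply/setP => w; rewrite !inE; case: (boolP (w \in V)) => [/nu->|]; rewrite ?andbT ?andbF.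
apply: IHm; last exact: indep_dom_ge_non_nbrs.
  by apply: leq_ltn_trans (subset_leq_card (sUD u)) (cardD u uV).
exact: subset_trans (sUD u) (subD u).
Qed.

(** The closed neighbourhoods of the points of [A] cover [V]. *)
Lemma dominating_card_le V A b :
  (forall a, #|[set w | (w == a) || e w a]| <= b) -> dominating V A ->
  #|V| <= #|A| * b.
Proof.
move=> degD domA.
have sV : V \subset \bigcup_(a in A) [set w | (w == a) || e w a].
  apply/subsetP => v vV; apply/bigcupP; case: (boolP (v \in A)) => vA.
    by exists v; rewrite // inE eqxx.
  by have [a aA eva] := domA v vV vA; exists a; rewrite // inE eva orbT.
apply: leq_trans (subset_leq_card sV) _; rewrite -sum_nat_const.
elim/big_rec2: _ => [|a X C _ leXC]; first by rewrite cards0.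
by rewrite (leq_trans (leq_card_setU _ _)) // leq_add.
Qed.

End Independence.

(** * Polynomials with supports in an interval *)

Section Supports.
Import GRing.Theory.
Local Open Scope ring_scope.
Variables (K : fieldType) (n : nat).
Local Notation S := {mpoly K[n]}.
Implicit Types (A C W : {set 'I_n}) (m : 'X_{1..n}) (p q : S).
Implicit Type L : ({set 'I_n} * {set 'I_n})%type.

Definition mset A : 'X_{1..n} := [multinom nat_of_bool (i \in A) | i < n].
Definition supp m : {set 'I_n} := [set i | m i != 0%N].

Lemma supp_mset A : supp (mset A) = A.
Proof. by apply/setP => i; rewrite inE mnmE; case: (i \in A). Qed.

Lemma suppD m m' : supp (m + m') = supp m :|: supp m'.
Proof. by apply/setP => i; rewrite !inE mnmDE addn_eq0 negb_and. Qed.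

Lemma mset_le A m : A \subset supp m -> (mset A <= m)%MM.
Proof.
move=> /subsetP sA; apply/mnm_lepP => i; rewrite mnmE.
by case: (boolP (i \in A)) => // /sA; rewrite inE lt0n.
Qed.

(** For L = [A, B] with A inside B, these polynomials form the Stanley space x^A K[B], as the next
    two lemmas show. *)
Definition supported L p := forall m, m \in msupp p -> between L (supp m).

Lemma supported_mul L p : L.1 \subset L.2 -> in_vars L.2 p ->
  supported L (p * 'X_[mset L.1]).
Proof.
move=> sL pL m; rewrite (perm_mem (msuppMX _ _)) => /mapP[m' m'p ->].
rewrite /between suppD supp_mset subsetUl subUset sL /=.
apply/subsetP => i; rewrite inE => mi; apply/negPn/negP => iL.
by rewrite (pL m' m'p i iL) in mi.
Qed.

Lemma supported_div L p : supported L p ->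
  exists2 q, in_vars L.2 q & p = q * 'X_[mset L.1].
Proof.
move=> pL; exists (\sum_(m <- msupp p) p@_m *: 'X_[m - mset L.1]).
  move=> m /msupp_sum_le /flattenP[_ /mapP[m' + ->]]; rewrite filter_predT.
  move=> /pL/andP[_ /subsetP sL] /msuppZ_le; rewrite msuppX inE => /eqP -> i.
  move=> iL; rewrite mnmBE; apply/eqP; rewrite subn_eq0.
  suff -> : m' i = 0%N by [].
  by apply/eqP/negPn/negP => mi; rewrite sL ?inE in iL.
rewrite mulr_suml {1}(mpolyE p); apply: eq_big_seq => m /pL/andP[sL _].
by rewrite -scalerAl -mpolyXD submK // mset_le.
Qed.

(** The K-linear projection of S onto the Stanley space of [L] along the other monomials. *)
Definition restrict L p : S :=
  \sum_(m <- msupp p | between L (supp m)) p@_m *: 'X_[m].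

Lemma mcoeff_restrict L p m :
  (restrict L p)@_m = if between L (supp m) then p@_m else 0.
Proof.
rewrite /restrict raddf_sum /=.
rewrite (eq_bigr (fun m' => if m' == m then p@_m else 0)) => [|m' _]; last first.
  rewrite mcoeffZ mcoeffX; case: eqP => [->|_]; by rewrite ?mulr1 ?mulr0.
case: (boolP (m \in msupp p)) => mp.
  rewrite big_mkcond (bigD1_seq m) //= eqxx big1 ?addr0 // => m' /negPf ->.
  by rewrite if_same.
rewrite big1_seq => [|m' /andP[_ m'p]].
  by rewrite (memN_msupp_eq0 mp) if_same.
by case: eqP => // E; rewrite -E m'p in mp.
Qed.

Lemma restrict_supported L p : supported L (restrict L p).
Proof.
move=> m; rewrite mcoeff_msupp mcoeff_restrict.
by case: ifP => //; rewrite eqxx.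
Qed.

Section Partition.
Variables (F : pred {set 'I_n}) (d : nat) (s : seq ({set 'I_n} * {set 'I_n})).
Hypothesis ps : interval_partition F d s.
Local Notation L i := (tnth (in_tuple s) i).

Lemma sum_between C :
  (\sum_(i < size s | between (L i) C) 1 = F C)%N.
Proof.
have [cs _] := ps; rewrite -cs -sum1_count.
by rewrite (big_tnth _ _ s).
Qed.

Lemma between_inj C i j : between (L i) C -> between (L j) C -> i = j.
Proof.
move=> iC jC; apply/eqP; apply: contraLR (leq_b1 (F C)) => ij.
rewrite -sum_between (bigD1 i) //= (bigD1 j) //=; last by rewrite jC eq_sym.
Qed.

Lemma sum_restrict p m :
  (\sum_(i < size s) restrict (L i) p)@_m = p@_m *+ F (supp m).
Proof.
rewrite -sum_between raddf_sum /= -sumrMnr [RHS]big_mkcond.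
by apply: eq_bigr => i _; rewrite mcoeff_restrict; case: ifP.
Qed.

(** Disjoint intervals share no monomial, so projecting the sum recovers each summand. This yields
    uniqueness in the Stanley decompositions. *)
Lemma restrict_sum (h : 'I_(size s) -> S) i :
  (forall i, supported (L i) (h i)) -> h i = restrict (L i) (\sum_j h j).
Proof.
move=> hL; apply/mpolyP => m; rewrite mcoeff_restrict raddf_sum /=.
case: ifP => iC; last first.
  by apply: memN_msupp_eq0; apply/negP => /hL; rewrite iC.
rewrite (bigD1 i) //= big1 ?addr0 // => j ji.
apply: memN_msupp_eq0; apply/negP => /hL /(between_inj iC) E.
by rewrite E eqxx in ji.
Qed.
End Partition.
End Supports.

(** * General bounds on the Stanley depth *)

Section DepthBounds.
Variables (K : fieldType) (n : nat).
Implicit Type M : gradedModule K n.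

(** The hypothesis [d <= n] accounts for the neutral element [n] of the minimum. *)
Lemma sdepth_dec_ge M (D : stanley_decomposition M) d : d <= n ->
  (forall i, d <= #|sd_vars (s := D) i|) -> d <= sdepth_dec D.
Proof.
move=> dn dD; rewrite /sdepth_dec; elim/big_rec: _ => // i x _ dx.
by rewrite leq_min dD.
Qed.

Lemma sdepth_dec_le M (D : stanley_decomposition M) i :
  sdepth_dec D <= #|sd_vars (s := D) i|.
Proof.
rewrite /sdepth_dec; have := mem_index_enum i.
elim: (index_enum _) => //= j r IHr; rewrite inE big_cons geq_min.
by move=> /predU1P[->|/IHr ->]; rewrite ?leqnn ?orbT.
Qed.

Lemma sdepth_dec_le_n M (D : stanley_decomposition M) : sdepth_dec D <= n.
Proof.
rewrite /sdepth_dec; elim/big_rec: _ => // i x _ dx.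
by rewrite geq_min dx orbT.
Qed.

Lemma sdepth_ge M (D : stanley_decomposition M) d :
  d <= sdepth_dec D -> d <= sdepth M.
Proof.
move=> dD; apply: leq_trans dD _; rewrite /sdepth.
have lt_D : sdepth_dec D < n.+1 by rewrite ltnS sdepth_dec_le_n.
apply: (bigmax_sup (Ordinal lt_D)) => //=.
by apply/asboolP; exists D.
Qed.

Lemma sdepth_le M d :
  (forall D : stanley_decomposition M, sdepth_dec D <= d) -> sdepth M <= d.
Proof. by move=> Dd; apply/bigmax_leqP => i /asboolP[D <-]. Qed.
End DepthBounds.

(** * Stanley decompositions of I and S/I *)

Section EdgeModules.
Import GRing.Theory.
Local Open Scope ring_scope.
Variables (K : fieldType) (n : nat) (e : rel 'I_n).
Hypothesis e_irr : irreflexive e.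
Local Notation S := {mpoly K[n]}.
Implicit Types (A C W : {set 'I_n}) (m : 'X_{1..n}) (p q : S).

Lemma edge_ideal_msupp p m :
  p \in edge_ideal e -> m \in msupp p -> dependent e (supp m).
Proof.
move=> /edge_idealP[c ->] /msupp_sum_le /flattenP[_ /mapP[i _ ->]].
move=> /msupp_sum_le /flattenP[_ /mapP[j + ->]]; rewrite mem_filter => /andP[eij _].
rewrite -mpolyXD (perm_mem (msuppMX _ _)) => /mapP[m' _ ->].
apply/dependentP; exists i, j.
by rewrite !inE !mnmDE !mnm1E !eqxx; split=> //; lia.
Qed.

(** Together with [edge_ideal_msupp], this makes I the K-span of the monomials whose support
    contains an edge. *)
Lemma edge_ideal_mem p :
  (forall m, m \in msupp p -> dependent e (supp m)) -> p \in edge_ideal e.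
Proof.
move=> pI; rewrite (mpolyE p) big_seq.
apply: (big_ind (fun q : S => q \in edge_ideal e)) => [||m /pI].
- exact: edge_ideal0.
- exact: edge_idealD.
move=> /dependentP[i [j []]]; rewrite !inE => mi mj eij.
(* Since i and j differ, having both in the support of m suffices for x_i x_j to divide it. *)
have le_m : (U_(i) + U_(j) <= m)%MM.
  apply/mnm_lepP => l; rewrite mnmDE !mnm1E.
  case: (eqVneq i l) => [<-|_] /=; last by case: eqP => // <-; rewrite lt0n.
  by case: eqP => [ji|_]; [rewrite ji e_irr in eij | rewrite addn0 lt0n].
rewrite -(submK le_m) mpolyXD scalerAl mpolyXD.
by apply/edge_idealM/edge_ideal_edge.
Qed.

Lemma edge_ideal_monomial m :
  ('X_[m] : S) \in edge_ideal e = dependent e (supp m).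
Proof.
apply/idP/idP => [/edge_ideal_msupp|mI]; first by apply; rewrite msuppX inE.
by apply: edge_ideal_mem => m'; rewrite msuppX inE => /eqP ->.
Qed.

Section IdealDecomposition.
Variables (d : nat) (s : seq ({set 'I_n} * {set 'I_n})).
Hypothesis ps : interval_partition (dep_sets e setT) d s.
Local Notation L i := (tnth (in_tuple s) i).

Lemma ideal_gen_in i : ('X_[mset (L i).1] : S) \in edge_ideal e.
Proof.
rewrite edge_ideal_monomial supp_mset.
by have /andP[] := interval_partition_bottom ps (mem_tnth i (in_tuple s)).
Qed.

Definition ideal_gen i : edge_ideal_module K e :=
  EdgeIdealSub (ideal_gen_in i).

Definition ideal_vars i : {set 'I_n} := (L i).2.

Lemma edge_ideal_valZ p (u : edge_ideal_module K e) :
  edge_ideal_val (p *: u) = p * edge_ideal_val u :> S.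
Proof. by []. Qed.

Lemma edge_ideal_val_sum (I : finType) (f : I -> edge_ideal_module K e) :
  edge_ideal_val (\sum_i f i) = \sum_i edge_ideal_val (f i) :> S.
Proof. exact: (raddf_sum (val : edge_ideal_sub K e -> S^o)). Qed.

Lemma ideal_homogeneous i : homogeneous (ideal_gen i).
Proof.
exists (mdegZ (mset (L i).1)); rewrite /= /edge_ideal_comp /=.
by rewrite -[X in mpoly_comp _ X]scale1r; apply: mpoly_comp_term.
Qed.

Lemma ideal_free i : stanley_free (ideal_gen i) (ideal_vars i).
Proof.
move=> p _ /(congr1 (@edge_ideal_val _ _ _)); rewrite edge_ideal_valZ /=.
move=> pX; apply/mpolyP => m; rewrite mcoeff0.
have := congr1 (mcoeff (mset (L i).1 + m)) pX.
by rewrite mcoeffMX => ->; apply: mcoeff0.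
Qed.

Lemma ideal_spaceP i u :
  stanley_space (ideal_gen i) (ideal_vars i) u <->
  supported (L i) (edge_ideal_val u).
Proof.
split=> [[p pW ->]|uL]; last first.
  by have [p pW uE] := supported_div uL; exists p => //; apply: val_inj.
rewrite edge_ideal_valZ; apply: supported_mul pW.
by have [_ /(_ _ (mem_tnth i (in_tuple s)))[]] := ps.
Qed.

Lemma ideal_restrict_in i (u : edge_ideal_module K e) :
  restrict (L i) (edge_ideal_val u) \in edge_ideal e.
Proof.
apply: edge_ideal_mem => m /restrict_supported.
by move=> /(interval_partition_sub ps (mem_tnth i (in_tuple s)))/andP[].
Qed.

Lemma ideal_direct (u : edge_ideal_module K e) :
  exists! f : {ffun 'I_(size s) -> edge_ideal_module K e},
    (forall i, stanley_space (ideal_gen i) (ideal_vars i) (f i)) /\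
    u = \sum_i f i.
Proof.
exists [ffun i => EdgeIdealSub (ideal_restrict_in i u)]; split.
  split=> [i|].
    by apply/ideal_spaceP; rewrite ffunE; apply: restrict_supported.
  apply: val_inj; rewrite [RHS]edge_ideal_val_sum; apply/mpolyP => m.
  under eq_bigr do rewrite ffunE /=.
  rewrite (sum_restrict ps) /dep_sets subsetT /=.
  case: (boolP (m \in msupp (edge_ideal_val u : S))) => mu.
    by rewrite (edge_ideal_msupp (edge_ideal_valP u) mu).
  by rewrite [LHS](memN_msupp_eq0 mu) [X in X *+ _](memN_msupp_eq0 mu) mul0rn.
move=> g [gL ->]; apply/ffunP => i; apply: val_inj; rewrite ffunE /=.
rewrite edge_ideal_val_sum -(restrict_sum ps) // => j.
exact/ideal_spaceP.
Qed.

Definition ideal_decomposition : stanley_decomposition (edge_ideal_module K e) :=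
  StanleyDecomposition ideal_homogeneous ideal_free ideal_direct.

End IdealDecomposition.

Lemma sdepth_edge_ideal_ge d : (d <= n)%N ->
  partitionable (dep_sets e setT) d -> (d <= sdepth (edge_ideal_module K e))%N.
Proof.
move=> dn [s ps]; apply: (sdepth_ge (D := ideal_decomposition ps)).
apply: sdepth_dec_ge => // i.
by have [_ /(_ _ (mem_tnth i (in_tuple s)))[]] := ps.
Qed.

Section QuotDecomposition.
Variables (d : nat) (s : seq ({set 'I_n} * {set 'I_n})).
Hypothesis ps : interval_partition (indep_sets e setT) d s.
Local Notation L i := (tnth (in_tuple s) i).

Definition quot_gen i : edge_quot_module K e := edge_pi e 'X_[mset (L i).1].
Definition quot_vars i : {set 'I_n} := (L i).2.

(** Elements of I have only monomials of dependent support, while the intervals consist of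
    independent sets: the projections factor through S/I. *)
Lemma restrict_edge_pi i p q : edge_pi e p = edge_pi e q ->
  restrict (L i) p = restrict (L i) q.
Proof.
move=> /edge_pi_eqP pq; apply/mpolyP => m; rewrite !mcoeff_restrict.
case: ifP => // /(interval_partition_sub ps (mem_tnth i (in_tuple s)))/andP[_ im].
apply/eqP; rewrite -subr_eq0 -mcoeffB mcoeff_eq0.
by apply: contra im => /(edge_ideal_msupp pq).
Qed.

Lemma restrict_id (L : ({set 'I_n} * {set 'I_n})%type) p :
  supported L p -> restrict L p = p.
Proof.
move=> pL; apply/mpolyP => m; rewrite mcoeff_restrict.
case: ifP => // Lm; apply/esym/memN_msupp_eq0.
by apply/negP => /pL; rewrite Lm.
Qed.

Lemma quot_homogeneous i : homogeneous (quot_gen i).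
Proof.
exists (mdegZ (mset (L i).1)); exists 'X_[mset (L i).1] => //.
by rewrite -[X in mpoly_comp _ X]scale1r; apply: mpoly_comp_term.
Qed.

Lemma quot_top_sub i : (L i).1 \subset (L i).2.
Proof. by have [_ /(_ _ (mem_tnth i (in_tuple s)))[]] := ps. Qed.

Lemma quot_free i : stanley_free (quot_gen i) (quot_vars i).
Proof.
move=> p pW; rewrite [_ *: _]edge_piZ => pX.
have {}pX : p * 'X_[mset (L i).1] = 0.
  rewrite -(restrict_id (supported_mul (quot_top_sub i) pW)).
  rewrite (restrict_edge_pi i (q := 0)); last by rewrite pX edge_pi0.
  by apply: restrict_id => m; rewrite msupp0.
apply/mpolyP => m; rewrite mcoeff0.
by rewrite -(mcoeffMX p (mset (L i).1)) pX mcoeff0.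
Qed.

Lemma quot_spaceP i u : stanley_space (quot_gen i) (quot_vars i) u <->
  exists2 p, supported (L i) p & u = edge_pi e p.
Proof.
split=> [[p pW ->]|[p /supported_div[q qW ->] ->]]; last first.
  by exists q => //; rewrite [RHS]edge_piZ.
exists (p * 'X_[mset (L i).1]); last exact: edge_piZ.
exact: supported_mul (quot_top_sub i) pW.
Qed.

Lemma quot_direct (u : edge_quot_module K e) :
  exists! f : {ffun 'I_(size s) -> edge_quot_module K e},
    (forall i, stanley_space (quot_gen i) (quot_vars i) (f i)) /\
    u = \sum_i f i.
Proof.
have [p ->] := edge_pi_surj u.
exists [ffun i => edge_pi e (restrict (L i) p)]; split.
  split=> [i|].
    rewrite ffunE; apply/quot_spaceP; exists (restrict (L i) p) => //.
    exact: restrict_supported.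
  under eq_bigr do rewrite ffunE /=.
  (* The projections together lose only the monomials of dependent support, which vanish in S/I. *)
  rewrite -[RHS]edge_pi_sum; apply/edge_pi_eqP/edge_ideal_mem => m.
  rewrite mcoeff_msupp mcoeffB (sum_restrict ps) /indep_sets subsetT /=.
  by apply: contraNT => /negPf ->; rewrite subrr.
move=> g [gL gE]; apply/ffunP => i; rewrite ffunE /=.
have /choice[h hP] : forall j, exists h, supported (L j) h /\ g j = edge_pi e h.
  by move=> j; have /quot_spaceP[h] := gL j; exists h.
have hL j : supported (L j) (h j) by have [] := hP j.
have [_ ->] := hP i; congr edge_pi; rewrite (restrict_sum ps i hL).
apply: restrict_edge_pi; rewrite [LHS]gE edge_pi_sum.
by apply: eq_bigr => j _; have [] := hP j.
Qed.

Definition quot_decomposition : stanley_decomposition (edge_quot_module K e) :=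
  StanleyDecomposition quot_homogeneous quot_free quot_direct.

End QuotDecomposition.

Lemma sdepth_edge_quot_ge d : (d <= n)%N ->
  partitionable (indep_sets e setT) d -> (d <= sdepth (edge_quot_module K e))%N.
Proof.
move=> dn [s ps]; apply: (sdepth_ge (D := quot_decomposition ps)).
apply: sdepth_dec_ge => // i.
by have [_ /(_ _ (mem_tnth i (in_tuple s)))[]] := ps.
Qed.

Lemma mdegZ_inj : injective (@mdegZ n).
Proof.
move=> m m' /rowP mm'; apply/mnmP => i.
by have := mm' i; rewrite !mxE => -[].
Qed.

(* The Stanley space containing x^A contains x^A x_w, nonzero in S/I, for each
   of its variables x_w; as A is maximal, all of these lie in A. *)
Lemma sdepth_edge_quot_le A : indep_sets e setT A -> dominating e setT A ->
  (sdepth (edge_quot_module K e) <= #|A|)%N.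
Proof.
move=> /andP[_ iA] domA; apply: sdepth_le => D.
have [f [[fD fE] _]] := sd_direct D (edge_pi e 'X_[mset A]).
(* Lift each component to S, as a coefficient in K[W_i] times a homogeneous representative of the
   generator. *)
have /choice[h hP] : forall i, exists h : S * S,
    [/\ in_vars (sd_vars (s := D) i) h.1, f i = edge_pi e (h.1 * h.2),
        sd_gen (s := D) i = edge_pi e h.2 & exists a, mpoly_comp a h.2].
  move=> i; have [a [r ra rE]] := sd_homogeneous (s := D) i.
  have [p pW fi] := fD i; exists (p, r); split=> //; last by exists a.
  by rewrite fi rE [LHS]edge_piZ.
have sumA : 'X_[mset A] - \sum_i (h i).1 * (h i).2 \in edge_ideal e.
  apply/edge_pi_eqP; rewrite [LHS]fE edge_pi_sum.
  by apply: eq_bigr => i _; have [] := hP i.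
have cA : (\sum_i (h i).1 * (h i).2)@_(mset A) = 1.
  have : ('X_[mset A] - \sum_i (h i).1 * (h i).2)@_(mset A) = 0.
    apply/eqP; rewrite mcoeff_eq0; apply: contra iA => /(edge_ideal_msupp sumA).
    by rewrite supp_mset.
  by rewrite mcoeffB mcoeffX eqxx => /eqP; rewrite subr_eq0 => /eqP <-.
have [i iE] : exists i, mset A \in msupp ((h i).1 * (h i).2).
  apply/existsP; apply: contraPT cA => /existsPn nA.
  rewrite raddf_sum /= big1 => [|i _]; last exact: memN_msupp_eq0.
  by move/eqP; rewrite eq_sym oner_eq0.
have [hW _ gE [a ha]] := hP i.
apply: leq_trans (sdepth_dec_le i) (subset_leq_card _).
apply/subsetP => w wW; apply/negPn/negP => wA.
have [b bA ewb] := domA w (in_setT w) wA.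
have /allpairsP[[m1 m2] /= [m1p m2r mE]] := msuppM_le iE.
(* As x^m2 is the only monomial of the homogeneous [(h i).2] and m1 + m2 is the exponent of x^A, [q]
   sends the generator to a multiple of x^A x_w, which is 0 in S/I; freeness then forces q = 0. *)
pose q : S := 'X_[m1 + U_(w)].
suff : q = 0 by move/eqP; rewrite -msupp_eq0 msuppX.
apply: (sd_free (s := D) (i := i)).
  move=> m; rewrite msuppX inE => /eqP -> j jW.
  rewrite mnmDE mnm1E (hW m1 m1p j jW).
  by case: eqP => // wj; rewrite -wj wW in jW.
rewrite gE [LHS]edge_piZ -[RHS](edge_pi0 K e); apply/edge_pi_eqP; rewrite subr0.
apply: edge_ideal_mem => m; rewrite mulrC (perm_mem (msuppMX _ _)).
move=> /mapP[m' m'r ->].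
have -> : m' = m2 by apply: mdegZ_inj; rewrite (ha _ m'r) (ha _ m2r).
have bE : (m1 b + m2 b)%N = 1%N by rewrite -mnmDE -mE mnmE bA.
apply/dependentP; exists w, b; rewrite !inE !mnmDE !mnm1E eqxx.
by split=> //; lia.
Qed.

End EdgeModules.

(** * Powers of cycles *)

Lemma card_ord_lt n m : m <= n -> #|[set i : 'I_n | i < m]| = m.
Proof.
move=> le_mn; rewrite -sum1_card; under eq_bigl do rewrite inE.
by rewrite -(big_ord_widen n (fun=> 1)) // sum1_card card_ord.
Qed.

Section CyclePower.
Variables n k : nat.
Local Notation e := (cycle_power n k).
Implicit Types (i j u v w : 'I_n) (A V : {set 'I_n}).

Lemma cycle_powerE i j : e i j =
  (i != j :> nat) && ((maxn i j - minn i j <= k) || (n - k <= maxn i j - minn i j)).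
Proof. by []. Qed.

Lemma cycle_power_sym : ssrbool.symmetric e.
Proof. by move=> i j; rewrite !cycle_powerE eq_sym maxnC minnC. Qed.

Lemma cycle_power_irr : irreflexive e.
Proof. by move=> i; rewrite cycle_powerE eqxx. Qed.

Lemma cycle_power_degree v :
  #|[set w | (w == v) || e w v]| <= 2 * k + 1.
Proof.
(* The displacement from v to w modulo n, chosen in [-k, k] and shifted by k; it determines w. *)
pose f w : 'I_(2 * k).+1 := inord
  (if (w <= v + k) && (v <= w + k) then w + k - v
   else if v < w then w + k - v - n else w + n + k - v).
rewrite -(card_in_imset (f := f)).
  by rewrite (leq_trans (max_card _)) // card_ord addn1.
move=> i j; rewrite !inE !cycle_powerE -!val_eqE /= => iv jv /(congr1 (@nat_of_ord _)).
have [[vn ltin] ltjn] := (ltn_ord v, ltn_ord i, ltn_ord j).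
by rewrite /f !inordK => [||]; do ?case: ifP => ?; move=> *; try apply: val_inj => /=; lia.
Qed.

(** Differences stay below n - k, so no edge wraps around. The neighbours of the least vertex u of V
    lie in [u, u + k], hence are pairwise adjacent. *)
Lemma chordal_on_path : chordal_on e [set i : 'I_n | i < n - k].
Proof.
move=> V /subsetP sV /set0Pn[i0 i0V].
case: (arg_minnP (fun i : 'I_n => val i) i0V) => u uV umin; exists u => // v w vV wV.
have := umin v vV; have := umin w wV; have := sV v vV; have := sV w wV.
rewrite !inE !cycle_powerE -val_eqE /=; lia.
Qed.

(** For positive d the first hypothesis says that d is at most ceil((n - k) / (2k + 1)). *)
Lemma indep_dom_ge_segment d m : d.-1 * (2 * k + 1) < n - k ->
  n - k <= m <= n -> indep_dom_ge e [set i : 'I_n | i < m] d.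
Proof.
move=> hd /andP[le_m le_n] A _ domA.
have := dominating_card_le cycle_power_degree domA; rewrite card_ord_lt // => leA.
have : d.-1 * (2 * k + 1) < #|A| * (2 * k + 1) by lia.
by rewrite ltn_mul2r => /andP[_]; lia.
Qed.

(** Starting from the path on the first n - k vertices, the others are put back one at a time. The
    vertex n - k + j is adjacent to 0 by wrap-around. *)
Lemma partitionable_dep_cycle d : k < n -> d.-1 * (2 * k + 1) < n - k ->
  partitionable (dep_sets e setT) d.+1.
Proof.
move=> lt_kn hd; have n_gt0 : 0 < n by lia.
have esym := cycle_power_sym; have eirr := cycle_power_irr.
suff H (j : nat) : j <= k -> partitionable (dep_sets e [set i : 'I_n | i < n - k + j]) d.+1.
  have -> : setT = [set i : 'I_n | i < n - k + k].
    by apply/setP => i; rewrite !inE; have := ltn_ord i; lia.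
  exact: H.
elim: j => [_|j IHj lt_jk].
  rewrite addn0; apply: (proj2 (chordal_good _ _ chordal_on_path _ _)) => //.
  by apply: indep_dom_ge_segment hd _; lia.
have lt_v : n - k + j < n by lia.
pose v := Ordinal lt_v; pose w := Ordinal n_gt0.
have vV : v \in [set i : 'I_n | i < n - k + j.+1] by rewrite inE /=; lia.
apply: (shed_dep esym eirr (v := v) (w := w)) => //.
- by rewrite inE /=; lia.
- by rewrite cycle_powerE /=; lia.
- suff -> : [set i : 'I_n | i < n - k + j.+1] :\ v = [set i : 'I_n | i < n - k + j].
    by apply: IHj; lia.
  by apply/setP => i; rewrite !inE -val_eqE /=; lia.
(* Vertices from n - k up to v are within k of v, so the non-neighbours of v all lie in the path. *)
apply: (chordal_good esym eirr chordal_on_path).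
  apply/subsetP => i; rewrite !inE cycle_powerE -val_eqE /=; lia.
apply: indep_dom_ge_non_nbrs => //.
by apply: indep_dom_ge_segment hd _; lia.
Qed.

(* The points floor (t n / m), t < m, have cyclic gaps between k + 1 and 2k + 1. *)
Lemma cycle_indep_dominating m :
  0 < n -> 1 < m -> m * (k + 1) <= n <= m * (2 * k + 1) ->
  exists A, [/\ indep_sets e setT A, dominating e setT A & #|A| <= m].
Proof.
move=> n_gt0 m_gt1 /andP[le_n ge_n]; have m_gt0 : 0 < m by lia.
pose p t := t * n %/ m.
have p0 : p 0 = 0 by rewrite /p mul0n div0n.
have pm : p m = n by rewrite /p mulKn.
have p_ge t : p t + (k + 1) <= p t.+1.
  rewrite /p addnC -divnMDl // leq_div2r // mulSn mulnC; lia.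
have p_le t : p t.+1 <= p t + (2 * k + 1).
  by rewrite /p [leqRHS]addnC -divnMDl // leq_div2r // mulSn; lia.
have p_mono s t : s < t -> p s + (k + 1) <= p t.
  move=> st; apply: leq_trans (p_ge s) _.
  by rewrite leq_div2r // leq_mul2r st orbT.
have p_lt t : t < m -> p t + (k + 1) <= n by move=> tm; rewrite -[leqRHS]pm; apply: p_mono.
have p_ltn (t : 'I_m) : p t < n by have := p_lt t (ltn_ord t); lia.
pose A := [set Ordinal (p_ltn t) | t in 'I_m].
have memA (i : 'I_n) t : t < m -> i = p t :> nat -> i \in A.
  by move=> tm iE; apply/imsetP; exists (Ordinal tm) => //; apply: val_inj.
exists A; split.
- rewrite /indep_sets subsetT /=; apply/dependentP => -[i [j []]].
  move=> /imsetP[s _ ->] /imsetP[t _ ->]; rewrite cycle_powerE /=.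
  have := p_lt _ (ltn_ord s); have := p_lt _ (ltn_ord t).
  case: (ltngtP s t) => [/p_mono|/p_mono|->]; rewrite ?eqxx //; lia.
- move=> i _ iA.
  have find (j : nat) : i < p j -> exists2 t, t < j & p t <= i < p t.+1.
    elim: j => [|j IHj]; first by rewrite p0.
    case: (ltnP i (p j)) => [/IHj[t tj it] _|le_i lt_i]; last by exists j; rewrite ?le_i.
    by exists t; rewrite // ltnW.
  have [t tm /andP[le_i lt_i]] := find m (eq_ind_r (leq i.+1) (ltn_ord i) pm).
  have := p_le t; have := p_lt t tm => ltn_t le_t.
  have lt_tn : p t < n by lia.
  case: (leqP i (p t + k)) => ik.
    exists (Ordinal lt_tn); first exact: memA tm _.
    have : i != p t :> nat by apply: contraNneq iA; apply: memA.
    by rewrite cycle_powerE /=; lia.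
  (* Now i is more than k past [p t]; as the gap is at most 2k + 1, the next point is at most k
     ahead. *)
  case: (ltnP t.+1 m) => tm1.
    have lt_t1n : p t.+1 < n by have := p_lt _ tm1; lia.
    exists (Ordinal lt_t1n); first exact: memA tm1 _.
    by rewrite cycle_powerE /=; lia.
  (* After the last point the next one around the cycle is 0, reached from i through [p m = n]. *)
  have tE : t.+1 = m by lia.
  exists (Ordinal n_gt0); first by apply: (memA _ 0) => //=; rewrite p0.
  rewrite cycle_powerE /=; move: le_t lt_i; rewrite tE pm; lia.
by rewrite (leq_trans (leq_imset_card _ _)) // card_ord.
Qed.

Section Complete.
Hypothesis le_n : n <= 2 * k + 1.

Lemma cycle_power_complete i j : e i j = (i != j).
Proof.
by rewrite cycle_powerE -val_eqE /=; have := ltn_ord i; have := ltn_ord j; lia.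
Qed.

Lemma complete_good : 0 < n -> good e setT 1.
Proof.
move=> n_gt0; apply: (chordal_good cycle_power_sym cycle_power_irr (U := setT)).
- move=> V _ /set0Pn[u uV]; exists u => // v w _ _ _ _.
  by rewrite cycle_power_complete.
- exact: subxx.
move=> A _ domA; rewrite card_gt0; apply/set0Pn.
case: (boolP (Ordinal n_gt0 \in A)) => [|nA]; first by exists (Ordinal n_gt0).
by have [a aA _] := domA _ (in_setT _) nA; exists a.
Qed.

Lemma complete_point v : indep_sets e setT [set v] /\ dominating e setT [set v].
Proof.
split.
  rewrite /indep_sets subsetT /=; apply/dependentP => -[i [j []]].
  by rewrite !inE => /eqP -> /eqP ->; rewrite cycle_power_irr.
by move=> w _; rewrite inE => wv; exists v; rewrite ?inE // cycle_power_complete.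
Qed.
End Complete.
End CyclePower.

(** * Comparison of the two depths *)

Theorem corollary5p5 (K : fieldType) (n k : nat) (hk : 1 <= k) (hn : 3 <= n) :
  let sdepth_I := sdepth (edge_ideal_module K (cycle_power n k)) in
  let sdepth_S_I := sdepth (edge_quot_module K (cycle_power n k)) in
  (n <= 2 * k + 1 -> 2 <= sdepth_I /\ 2 = sdepth_S_I + 1) /\
  (2 * k + 2 <= n ->
     (1 <= n %% (2 * k + 1) <= k -> sdepth_S_I <= sdepth_I) /\
     (n %% (2 * k + 1) = 0 \/ k + 1 <= n %% (2 * k + 1) <= 2 * k ->
        sdepth_S_I + 1 <= sdepth_I)).
Proof.
move=> sI sQ; have n_gt0 : 0 < n by lia.
have esym := @cycle_power_sym n k; have eirr := @cycle_power_irr n k.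
split=> [le_n|ge_n].
  have [pQ pI] := complete_good le_n n_gt0.
  have geQ := sdepth_edge_quot_ge K eirr (d := 1) (leq_trans (isT : 1 <= 3) hn) pQ.
  have geI := sdepth_edge_ideal_ge K eirr (d := 2) (leq_trans (isT : 2 <= 3) hn) pI.
  have [iA dA] := complete_point le_n (Ordinal n_gt0).
  have := sdepth_edge_quot_le K eirr iA dA; rewrite cards1.
  by rewrite /sI /sQ; lia.
have geI d : d.-1 * (2 * k + 1) < n - k -> d.+1 <= sI.
  move=> hd; apply: sdepth_edge_ideal_ge => //.
    have k_gt0 : 0 < 2 * k + 1 by lia.
    by have := leq_pmulr d.-1 k_gt0; lia.
  by apply: partitionable_dep_cycle hd; lia.
have leQ m : 1 < m -> m * (k + 1) <= n <= m * (2 * k + 1) -> sQ <= m.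
  move=> m1 hm; have [A [iA dA cA]] := cycle_indep_dominating n_gt0 m1 hm.
  exact: leq_trans (sdepth_edge_quot_le K eirr iA dA) cA.
have := divn_eq n (2 * k + 1).
set q := n %/ _; set r := n %% _ => nE.
have q_gt0 : 0 < q by rewrite divn_gt0; lia.
split=> [/andP[r_ge1 r_le]|].
  (* Both bounds are q + 1, since n - k exceeds (q - 1)(2k + 1). *)
  apply: leq_trans (leQ q.+1 _ _) (geI q _); nia.
case=> [r0|/andP[r_ge r_le]].
  (* With r = 0, n >= 2k + 2 forces q >= 2, as [leQ] demands; the bounds are q and q + 1. *)
  rewrite addn1; apply: leq_ltn_trans (leQ q _ _) (geI q _); nia.
(* For r > k, n - k exceeds q(2k + 1), and the bounds are q + 1 and q + 2. *)
rewrite addn1; apply: leq_ltn_trans (leQ q.+1 _ _) (geI q.+1 _); nia.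
Qed.
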